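(* For any $\ell\in\tfrac12\mathbb N$ and all $y\in[0,1]$, $$\Psi_0(y)=K\,\Upsilon(y)\,K,$$ where $K$ is the constant $(2\ell+1)\times(2\ell+1)$ matrix $K_{i,j}=K_j(i,\tfrac12,2\ell)$, $i,j\in\{0,\dots,2\ell\}$, and $\Upsilon(y)$ is the diagonal matrix $$\Upsilon(y)_{j,j}=(-1)^{\frac{3j}{2}}\binom{2\ell}{j}\,y^{\frac j2}(1-y)^{\frac{2\ell-j}{2}},\qquad j=0,\dots,2\ell .$$
   Context: $K_n(x,p,N)={}_2F_1(-n,-x;-N;1/p)$, $n,x\in\{0,\dots,N\}$, are the Krawtchouk polynomials (terminating sum). $(-1)^{3j/2}$ means $e^{3\pi i j/2}=(-i)^j$. The matrix function $\Phi_0$ (the full spherical function of degree zero for $(\mathrm{SU}(2)\times\mathrm{SU}(2),\mathrm{diag}\,\mathrm{SU}(2))$) is, for $n,m\in\{0,\dots,2\ell\}$, $$(\Phi_0(t))_{n,m}=\sum_{j_1=-\frac n2}^{\frac n2}\ \sum_{j_2=-\frac{2\ell-n}{2}}^{\frac{2\ell-n}{2}}\delta_{-\ell+m,\,j_1+j_2}\binom{n}{j_1+\frac n2}\binom{2\ell-n}{j_2+\frac{2\ell-n}{2}}\binom{2\ell}{2\ell-m}^{-1}e^{i(j_2-j_1)t},$$ where $j_1,j_2$ run in unit steps, and $\Psi_0(y)=\Phi_0(\arccos(1-2y))$ for $y\in[0,1]$. *)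

(* Defs.v *)
From HB Require Import structures.
From mathcomp Require Import all_boot all_order all_algebra.
From mathcomp Require Import reals trigo exp.
From mathcomp Require Import complex.

Set Implicit Arguments.
Unset Strict Implicit.
Unset Printing Implicit Defensive.

Import Order.TTheory GRing.Theory Num.Theory.

Local Open Scope ring_scope.
Local Open Scope complex_scope.

Section Krawtchouk.
Variable F : fieldType.

(* Pochhammer symbol (a)_k = a (a + 1) ... (a + k - 1). *)
Definition poch (a : F) (k : nat) : F := \prod_(i < k) (a + i%:R).

(* Terminating series 2F1(-n, b; c; z): (-n)_k vanishes for k > n, which fixes
   the range of summation even when c is a nonpositive integer <= -n. *)
Definition hyp2F1 (n : nat) (b c z : F) : F :=
  \sum_(k < n.+1) poch (- n%:R) k * poch b k / (poch c k * k`!%:R) * z ^+ k.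

(* K_n(x, p, N) *)
Definition krawtchouk (n : nat) (x p : F) (N : nat) : F :=
  hyp2F1 n (- x) (- N%:R) (1 / p).

End Krawtchouk.

Section Spherical.
Variable R : realType.

(* e^{i t} for real t. *)
Definition expi (t : R) : R[i] := cos t +i* sin t.

(* The half-integer ell is represented by the natural number N = 2 ell;
   matrices have rows and columns indexed by {0, ..., N}. *)

(* The half-integers -n/2, -n/2 + 1, ..., n/2. *)
Definition halfint (n : nat) (k : 'I_n.+1) : R := - (n%:R / 2) + k%:R.

(* With j1 = halfint k1 and j2 = halfint k2, the lower indices j1 + n/2 and
   j2 + (2 ell - n)/2 of the binomials are k1 and k2. *)
Definition Phi0 (N : nat) (t : R) : 'M[R[i]]_N.+1 :=
  \matrix_(n < N.+1, m < N.+1)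
    \sum_(k1 < n.+1) \sum_(k2 < (N - n).+1)
      let ell : R := N%:R / 2 in
      let j1 := halfint k1 in
      let j2 := halfint k2 in
      (- ell + m%:R == j1 + j2)%:R * 'C(n, k1)%:R * 'C(N - n, k2)%:R
        * ('C(N, N - m)%:R)^-1 * expi ((j2 - j1) * t).

Definition Psi0 (N : nat) (y : R) : 'M[R[i]]_N.+1 := Phi0 N (acos (1 - 2 * y)).

Definition Kmx (N : nat) : 'M[R[i]]_N.+1 :=
  \matrix_(i < N.+1, j < N.+1) krawtchouk j (i%:R : R[i]) (1 / 2) N.

(* (-1)^{3j/2} is read as e^{3 pi i j / 2}. *)
Definition Upsilon (N : nat) (y : R) : 'M[R[i]]_N.+1 :=
  diag_mx (\row_(j < N.+1)
    (expi (3 * pi * j%:R / 2) * 'C(N, j)%:R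
       * (powR y (j%:R / 2) * powR (1 - y) ((N - j)%:R / 2))%:C)).

End Spherical.

(* Main.v *)
(* Multiply the entry (n, m) by binom(N, m) and read it as the coefficient of
   X^m of a polynomial.  With a = e^{i t/2}, row n of Phi0 becomes
     (a + a^-1 X)^n (a^-1 + a X)^(N - n).
   The Krawtchouk generating function
     sum_j binom(N, j) K_j(x) u^j v^(N - j) = (v - u)^x (v + u)^(N - x),
   applied first with u = X, v = 1 and then with u = -i sin(t/2) (1 - X),
   v = cos(t/2) (1 + X), turns row n of K Upsilon K into the same polynomial. *)
Require Import Defs.
From mathcomp Require Import all_boot all_order all_algebra.
From mathcomp Require Import reals complex.
From mathcomp Require Import trigo exp ring lra.
Import GRing.Theory Num.Theory.
Local Open Scope ring_scope.

(** Both sides count the [j]-subsets of an [N]-set together with an injective [k]-tuple in the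
    subset. The proof multiplies by [(j - k)! (N - j)!], which turns both sides into [N!]. *)
Lemma bin_mul_ffact (N j k : nat) : (k <= j <= N)%N ->
  ('C(N, j) * j ^_ k = N ^_ k * 'C(N - k, j - k))%N.
Proof.
move=> /andP[kj jN].
apply/eqP; rewrite -(eqn_pmul2r (fact_gt0 (j - k))) -mulnA ffact_fact //.
rewrite -(eqn_pmul2r (fact_gt0 (N - j))) -mulnA bin_fact // -!mulnA.
have -> : (N - j = (N - k) - (j - k))%N by rewrite subnBA // subnK // (leq_trans kj).
by rewrite bin_fact ?leq_sub2r // ffact_fact // (leq_trans kj).
Qed.

Lemma poch_opp_nat (F : fieldType) (n k : nat) :
  poch (- n%:R : F) k = (-1) ^+ k * (n ^_ k)%:R.
Proof.
rewrite /poch; elim: k => [|k IHk]; first by rewrite big_ord0 mul1r.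
rewrite big_ord_recr /= IHk ffactnSr exprSr natrM.
have [kn|nk] := leqP k n; last by rewrite ffact_small // mulr0 !mul0r mulr0.
by rewrite natrB //; ring.
Qed.

(** The binomial factor absorbs the denominator [(-N)_k], which is nonzero because [k <= j <= N].
    The surviving sign [(-1)^k] and [1/p = 2] combine into [(-2)^k]. *)
Lemma bin_mul_krawtchouk (F : numFieldType) (N x j : nat) : (j <= N)%N ->
  'C(N, j)%:R * krawtchouk j (x%:R : F) (1 / 2) N =
  \sum_(k < j.+1) (-2) ^+ k * ('C(x, k) * 'C(N - k, j - k))%:R.
Proof.
move=> jN; rewrite /krawtchouk /hyp2F1 mulr_sumr; apply: eq_bigr => k _.
have kj : (k <= j)%N by rewrite -ltnS.
rewrite !poch_opp_nat -(bin_ffact x) !div1r invrK.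
have N0 : (N ^_ k)%:R != 0 :> F by rewrite pnatr_eq0 -lt0n ffact_gt0 (leq_trans kj).
have k0 : (k`!)%:R != 0 :> F by rewrite pnatr_eq0 -lt0n fact_gt0.
have := bin_mul_ffact N j k; rewrite kj jN => /(_ isT).
move/(congr1 (fun n => n%:R : F)); rewrite !natrM => E.
rewrite -[-2]mulN1r exprMn.
have s0 : (-1) ^+ k != 0 :> F by rewrite expf_neq0 // oppr_eq0 oner_eq0.
transitivity (('C(N, j)%:R * (j ^_ k)%:R) *
    ((-1) ^+ k * 2 ^+ k * 'C(x, k)%:R / (N ^_ k)%:R) : F).
  by field; rewrite s0 N0 k0.
by rewrite E; field.
Qed.

Lemma krawtchouk_gen (F : numFieldType) (A : comAlgType F) (N x : nat) (u v : A) :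
  (x <= N)%N ->
  \sum_(j < N.+1) ('C(N, j)%:R * krawtchouk j (x%:R : F) (1 / 2) N) *:
     (u ^+ j * v ^+ (N - j)) = (v - u) ^+ x * (v + u) ^+ (N - x).
Proof.
move=> xN.
(* For fixed [k], the sum over [j] is the binomial theorem shifted by [k]. *)
have E k : (k <= N)%N -> \sum_(j < N.+1 | (k <= j)%N)
    'C(N - k, j - k)%:R *: (u ^+ j * v ^+ (N - j)) = u ^+ k * (v + u) ^+ (N - k).
  move=> kN; transitivity (\sum_(k <= j < N.+1)
      'C(N - k, j - k)%:R *: (u ^+ j * v ^+ (N - j))); first by rewrite big_geq_mkord.
  rewrite -{1}[k]add0n big_addn big_mkord subSn // exprDn mulr_sumr.
  apply: eq_bigr => i _; rewrite addnK scaler_nat mulrnAr addnC exprD subnDA.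
  by rewrite -mulrA [X in _ * X]mulrC.
transitivity (\sum_(k < N.+1) \sum_(j < N.+1 | (k <= j)%N)
   ((-2) ^+ k * 'C(x, k)%:R) *: ('C(N - k, j - k)%:R *: (u ^+ j * v ^+ (N - j)))).
  rewrite (exchange_big_dep xpredT) //=; apply: eq_bigr => j _.
  rewrite bin_mul_krawtchouk ?leq_ord // scaler_suml.
  rewrite (big_ord_widen N.+1 (fun k =>
    ((-2) ^+ k * ('C(x, k) * 'C(N - k, j - k))%:R) *: (u ^+ j * v ^+ (N - j)))) //.
  by apply: eq_bigr => k _; rewrite scalerA natrM mulrA.
under eq_bigr => k _ do rewrite -scaler_sumr E ?leq_ord //.
(* Expanding the [x]-th power of this sum produces the factors [(-2)^k 'C(x, k)]. *)
have -> : v - u = (v + u) + (-2 : F) *: u.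
  by rewrite scaleNr scaler_nat mulr2n opprD addrA addrK.
rewrite exprDn mulr_suml.
rewrite (big_ord_widen N.+1 (fun i =>
  (v + u) ^+ (x - i) * ((-2 : F) *: u) ^+ i *+ 'C(x, i) * (v + u) ^+ (N - x))) //.
rewrite [RHS]big_mkcond /=; apply: eq_bigr => k _; rewrite ltnS.
case: leqP => [kx|xk]; last by rewrite bin_small // mulr0 scale0r.
have -> : (N - k = (x - k) + (N - x))%N by rewrite addnC addnBA // subnK.
rewrite exprD exprZn -scalerA scaler_nat -scalerAr scalerMnr -scalerAl.
by rewrite mulrnAl mulrA [u ^+ k * _]mulrC.
Qed.

Lemma expiD (R : realType) (s t : R) : expi (s + t) = expi s * expi t.
Proof.
apply/eqP; rewrite eq_complex /= cosD sinD eqxx /=.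
by apply/eqP; ring.
Qed.

Lemma expiMn (R : realType) (t : R) (n : nat) : expi (t * n%:R) = expi t ^+ n.
Proof.
elim: n => [|n IHn]; first by rewrite mulr0 /expi cos0 sin0.
by rewrite -addn1 natrD mulrDr mulr1 expiD IHn addn1 exprSr.
Qed.

Lemma exprDZX (F : comNzRingType) (a b : F) (n : nat) :
  (a%:P + b *: 'X) ^+ n = \sum_(k < n.+1) (a ^+ (n - k) * b ^+ k *+ 'C(n, k)) *: 'X^k.
Proof.
rewrite exprDn; apply: eq_bigr => k _.
by rewrite exprZn -rmorphXn /= mul_polyC scalerA -scalerMnl.
Qed.

Lemma Phi0_coef (R : realType) (N : nat) (t : R) (n m : 'I_N.+1) :
  let a := expi (t / 2) in let b := expi (- (t / 2)) in
  'C(N, m)%:R * Phi0 N t n m =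
  ((a%:P + b *: 'X) ^+ n * (b%:P + a *: 'X) ^+ (N - n))`_m.
Proof.
move=> a b; have nN : (n <= N)%N by rewrite -ltnS.
have mN : (m <= N)%N by rewrite -ltnS.
rewrite !exprDZX big_distrlr /= coef_sum mxE mulr_sumr; apply: eq_bigr => k1 _.
rewrite coef_sum mulr_sumr; apply: eq_bigr => k2 _.
have k1n : (k1 <= n)%N by rewrite -ltnS.
have k2n : (k2 <= N - n)%N by rewrite -ltnS.
rewrite -scalerAl -scalerAr scalerA -exprD coefZ coefXn /=.
(* The half-integer shifts cancel since [n/2 + (N - n)/2 = N/2], so the Kronecker delta selects the
   monomial of degree [m]. *)
have -> : (- (N%:R / 2) + m%:R == halfint R k1 + halfint R k2) =
    (m == k1 + k2 :> nat)%N.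
  rewrite -(eqr_nat R) natrD /halfint natrB // -subr_eq0 -[RHS]subr_eq0.
  by congr (_ == 0); field.
(* Here [2 (j2 - j1) = (n - k1) - k1 - (N - n - k2) + k2]. *)
have -> : expi ((halfint R k2 - halfint R k1) * t) =
    a ^+ (n - k1) * b ^+ k1 * (b ^+ (N - n - k2) * a ^+ k2).
  rewrite -!expiMn -!expiD; congr expi.
  by rewrite /halfint !natrB //; field.
have C0 : 'C(N, m)%:R != 0 :> R[i] by rewrite pnatr_eq0 -lt0n bin_gt0.
by rewrite bin_sub // -!(mulr_natr (_ * _)); field; exact: C0.
Qed.

(** Half-angle formulas; the nonnegative roots are the right ones because the half angle lies in
    [[0, pi/2]]. *)
Lemma sin_cos_half_acos (R : realType) (y : R) : 0 <= y <= 1 ->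
  sin (acos (1 - 2 * y) / 2) = y `^ 2^-1 /\
  cos (acos (1 - 2 * y) / 2) = (1 - y) `^ 2^-1.
Proof.
move=> /andP[y0 y1].
have y11 : -1 <= 1 - 2 * y <= 1 by lra.
set t := acos _; have ct : cos t = 1 - 2 * y by apply: acosK; rewrite in_itv.
have t0 : 0 <= t by apply: acos_ge0.
have tpi : t <= pi by apply: acos_lepi.
have s0 : 0 <= sin (t / 2) by apply: sin_ge0_pi; lra.
have c0 : 0 <= cos (t / 2) by apply: cos_ge0_pihalf; lra.
have E := cos2Dsin2 (t / 2).
have : cos (t / 2 + t / 2) = cos t by congr cos; field.
rewrite cosD ct => E2.
rewrite !powR12_sqrt //; last by lra.
split; apply/eqP; rewrite -(@eqrXn2 _ 2) ?sqrtr_ge0 // sqr_sqrtr; lra.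
Qed.

(** Since [e^{3 pi i/2} = -i], the phase merges with the powers of the sine, giving the form needed
    in the generating function. *)
Lemma Upsilon_diag (R : realType) (N : nat) (y : R) (hy : 0 <= y <= 1)
    (j : 'I_N.+1) :
  let t := acos (1 - 2 * y) / 2 in
  expi (3 * pi * j%:R / 2) * 'C(N, j)%:R
       * (powR y (j%:R / 2) * powR (1 - y) ((N - j)%:R / 2))%:C%C =
  'C(N, j)%:R * ((- 'i * (sin t)%:C) ^+ j * (cos t)%:C ^+ (N - j))%C.
Proof.
move=> t; have [-> ->] := sin_cos_half_acos _ _ hy.
have -> : 3 * pi * j%:R / 2 = (3 * pi / 2) * j%:R :> R by field.
rewrite expiMn.
have -> : expi (3 * pi / 2 : R) = (- 'i)%C.
  have -> : 3 * pi / 2 = pi / 2 + pi :> R by field.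
  rewrite /expi cosDpi sinDpi cos_pihalf sin_pihalf.
  by apply/eqP; rewrite eq_complex /= oppr0 !eqxx.
have P z n : (z : R) `^ (n%:R / 2) = (z `^ 2^-1) ^+ n.
  by rewrite -powR_mulrn ?powR_ge0 // -powRrM mulrC.
by rewrite !P rmorphM !rmorphXn exprMn /=; ring.
Qed.

(* N = 2 ell, so that N ranging over nat means ell ranging over (1/2)N. *)
Theorem theorem3p1 (R : realType) (N : nat) (y : R) (hy : 0 <= y <= 1) :
  Psi0 N y = Kmx R N *m Upsilon N y *m Kmx R N.
Proof.
apply/matrixP => n m; have mN : (m <= N)%N by rewrite -ltnS.
have C0 : 'C(N, m)%:R != 0 :> R[i] by rewrite pnatr_eq0 -lt0n bin_gt0.
apply: (mulfI C0); rewrite /Psi0 Phi0_coef.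
set t := acos _ / 2; pose s : R[i] := (- 'i * (sin t)%:C)%C.
pose c : R[i] := (cos t)%:C%C.
have ea : expi t = c - s by rewrite /s /c /expi; simpc.
have eb : expi (- t) = c + s by rewrite /s /c /expi cosN sinN; simpc.
(* Chosen so that [v - u] and [v + u] are the two linear factors of the row polynomial. *)
pose u : {poly R[i]} := s *: (1 - 'X); pose v : {poly R[i]} := c *: (1 + 'X).
have -> : (expi t)%:P + expi (- t) *: 'X = v - u.
  by rewrite ea eb /u /v -!mul_polyC polyCD polyCN polyCD; ring.
have -> : (expi (- t))%:P + expi t *: 'X = v + u.
  by rewrite ea eb /u /v -!mul_polyC polyCD polyCD polyCN; ring.
rewrite -krawtchouk_gen ?leq_ord // coef_sum mxE mulr_sumr; apply: eq_bigr => j _.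
rewrite mul_mx_diag !mxE Upsilon_diag // -/t -/s -/c.
rewrite !exprZn -scalerAl -scalerAr !coefZ.
(* The right-hand factor [K]: the coefficient of [X^m] here is ['C(N, m)] times its entry
   [(j, m)]. *)
have -> : (1 - 'X) ^+ j * (1 + 'X) ^+ (N - j) =
    \sum_(k < N.+1)
      ('C(N, k)%:R * krawtchouk k (j%:R : R[i]) (1 / 2) N) *: 'X^k.
  rewrite -krawtchouk_gen ?leq_ord //.
  by apply: eq_bigr => k _; rewrite expr1n mulr1.
rewrite coef_sum (bigD1 m) //= coefZ coefXn eqxx big1 ?addr0; last first.
  by move=> k; rewrite -val_eqE eq_sym coefZ coefXn => /negPf /= ->; rewrite !mulr0.
(* The two sides mention [krawtchouk j] over convertible but distinct field
   structures on R[i], which [ring] would treat as different atoms. *)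
rewrite mulr1; pose Kj : R[i] := krawtchouk j n%:R (1 / 2) N.
by rewrite -[krawtchouk j _ _ _ in LHS]/Kj -[krawtchouk j _ _ _ in RHS]/Kj; ring.
Qed.
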